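(* For every $n$ and every $\alpha$ with $0\le\alpha<1$, the complement $\overline{P_n}$ of the path $P_n$ is determined by its $A_\alpha$-spectrum.
   Context: All graphs are finite, simple and undirected. For a graph $G$, $A(G)$ is its adjacency matrix, $D(G)$ its diagonal degree matrix, and $A_\alpha(G)=\alpha D(G)+(1-\alpha)A(G)$. The $A_\alpha$-spectrum of $G$ is the multiset of eigenvalues of $A_\alpha(G)$; $G$ is determined by its $A_\alpha$-spectrum if every graph with the same $A_\alpha$-spectrum is isomorphic to $G$. *)

(* Defs.v *)
From HB Require Import structures.
From mathcomp Require Import all_boot all_order all_algebra.
Set Implicit Arguments. Unset Strict Implicit. Unset Printing Implicit Defensive.
Import Order.TTheory GRing.Theory Num.Theory.
Local Open Scope ring_scope.

Definition simple_graph (n : nat) (e : rel 'I_n) : Prop :=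
  symmetric e /\ irreflexive e.

Definition adj_mx (R : pzRingType) (n : nat) (e : rel 'I_n) : 'M[R]_n :=
  \matrix_(i, j) (e i j)%:R.

Definition vdeg (n : nat) (e : rel 'I_n) (i : 'I_n) : nat := #|[pred j | e i j]|.

Definition deg_mx (R : pzRingType) (n : nat) (e : rel 'I_n) : 'M[R]_n :=
  \matrix_(i, j) ((i == j) * vdeg e i)%:R.

Definition Aalpha_mx (R : comNzRingType) (alpha : R) (n : nat) (e : rel 'I_n)
  : 'M[R]_n :=
  alpha *: deg_mx R e + (1 - alpha) *: adj_mx R e.

(* Two graphs have the same A_alpha-spectrum (multiset of eigenvalues) iff
   their A_alpha matrices have the same characteristic polynomial (the
   matrices are real symmetric, so the characteristic polynomial splits
   and its roots with multiplicity are exactly the eigenvalues). *)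
Definition same_Aalpha_spectrum (R : comNzRingType) (alpha : R) (m n : nat)
  (e1 : rel 'I_m) (e2 : rel 'I_n) : Prop :=
  char_poly (Aalpha_mx alpha e1) = char_poly (Aalpha_mx alpha e2).

Definition graph_iso (m n : nat) (e1 : rel 'I_m) (e2 : rel 'I_n) : Prop :=
  exists f : 'I_m -> 'I_n, bijective f /\ forall i j, e1 i j = e2 (f i) (f j).

Definition path_rel (n : nat) : rel 'I_n :=
  fun i j => ((i : nat).+1 == j) || ((j : nat).+1 == i).

Definition compl_rel (n : nat) (e : rel 'I_n) : rel 'I_n :=
  fun i j => (i != j) && ~~ e i j.

Definition DAalphaS (R : comNzRingType) (alpha : R) (n : nat) (e : rel 'I_n)
  : Prop :=
  forall (m : nat) (e' : rel 'I_m), simple_graph e' ->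
    same_Aalpha_spectrum alpha e' e -> graph_iso e' e.

(* Main.v *)
Require Import Defs.
From HB Require Import structures.
From mathcomp Require Import all_boot all_order all_algebra all_fingroup.
From mathcomp Require Import spectral sesquilinear complex.
From mathcomp Require Import ring lra zify.
Import Order.TTheory GRing.Theory Num.Theory.
Set Implicit Arguments. Unset Strict Implicit. Unset Printing Implicit Defensive.
Local Open Scope ring_scope.

(** Let H be the complement of a graph cospectral with the complement of the
path P_n. Up to a scalar matrix and a sign, the A_alpha-matrix of the complement
of a graph is X = A_alpha - (1 - alpha) J, with J the all-ones matrix, so X(H)
and X(P_n) are similar over the complex numbers.

For alpha > 0, the traces of X and X^2 give the sum of the degrees d of H and
of their squares, whence the sum of (d - 1)(d - 2) is 0. For alpha = 0, let T be
half this sum. The second and third moments give n - 1 edges and exactly T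
triangles, so 2T <= n - 2; the fourth moment forces the sum of (d_u - 2)(d_v - 2)
over the ordered pairs of adjacent vertices to be at least T(2n - 7), while it
is at most about T^2. Hence T = 0. In both cases all degrees are 1 or 2, and H
is a path or a path together with cycles.

A cycle of length s would contribute to X(H) the two eigenvectors (z^i)_i and
(z^-i)_i, where z is an s-th root of unity with z^2 <> 1 and real part at least
-1/2, and so an eigenvalue of multiplicity at least 2. For X(P_n) the
eigenvector equation is a second-order linear recurrence with constant
coefficients; a first integral of this recurrence shows that for n >= 5 such an
eigenvalue is simple. *)

(** * Cospectral symmetric matrices *)

Lemma char_poly_conj (F : fieldType) n (P A B : 'M[F]_n) :
  P \in unitmx -> P *m A = B *m P -> char_poly A = char_poly B.
Proof.
move=> uP PA; rewrite /char_poly.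
set Q : 'M[{poly F}]_n := map_mx polyC P.
have QA : Q *m char_poly_mx A = char_poly_mx B *m Q.
  rewrite /char_poly_mx mulmxBr mulmxBl scalar_mxC; congr (_ - _).
  by rewrite -!map_mxM PA.
have dQ : \det Q != 0.
  rewrite det_map_mx polyC_eq0; move: uP; rewrite unitmxE unitfE //.
apply: (mulfI dQ).
by rewrite -det_mulmx QA det_mulmx mulrC.
Qed.

Lemma diag_mx_perm (F : fieldType) n (d : 'rV[F]_n) (s : 'S_n) :
  perm_mx s *m diag_mx d = diag_mx (\row_i d 0 (s i)) *m perm_mx s.
Proof.
apply/matrixP=> i j; rewrite -row_permE mxE mul_diag_mx !mxE.
rewrite mulr_natr; case: eqP => [->|_] //=.
Qed.

(** The spectral theorem for normal matrices diagonalises both over [R[i]]. Equal characteristic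
    polynomials make the two diagonals permutations of each other, so a permutation matrix matches
    the eigenbases. *)
Lemma symmetric_cospectral_similar (R : rcfType) n (A B : 'M[R]_n) :
  A^T = A -> B^T = B -> char_poly A = char_poly B ->
  exists2 P : 'M[R[i]]_n, P \in unitmx &
    P *m map_mx (real_complex R) A = map_mx (real_complex R) B *m P.
Proof.
move=> symA symB eqAB; set f := real_complex R.
have spec (M : 'M[R]_n) : M^T = M -> exists (P : 'M[R[i]]_n) (d : 'rV_n),
    P \in unitmx /\ P *m map_mx f M = diag_mx d *m P.
  move=> symM; have /orthomx_spectralP defM : map_mx f M \is normalmx.
    apply: symmetric_normalmx.
      by apply/is_hermitianmxP; rewrite expr0 scale1r map_mx_id // map_trmx symM.
    by apply/mxOverP => i j; rewrite mxE; apply/complex_realP; exists (M i j).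
  exists (spectralmx (map_mx f M)), (spectral_diag (map_mx f M)).
  have uP := spectral_unit (map_mx f M); split=> //.
  move: uP defM; rewrite /=; move: (spectralmx _) (spectral_diag _) => P d uP ->.
  by rewrite -!mulmxA mulKVmx.
have [P [d [uP PA]]] := spec A symA.
have [Q [e [uQ QB]]] := spec B symB.
have cpD (c : 'rV[R[i]]_n) :
    char_poly (diag_mx c) = \prod_(x <- [tuple c 0 i | i < n]) ('X - x%:P).
  rewrite char_poly_trig ?diag_mx_is_trig // big_map big_enum /=.
  by apply: eq_bigr => i _; rewrite mxE eqxx mulr1n.
have : char_poly (diag_mx d) = char_poly (diag_mx e).
  rewrite -(char_poly_conj uP PA) -(char_poly_conj uQ QB) -!map_char_poly.
  by rewrite eqAB.
rewrite !cpD => /prod_XsubC_eq /tuple_permP[s eq_de].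
have {}eq_de : d = \row_i e 0 (s i).
  apply/rowP=> i; rewrite mxE.
  have := congr1 (fun t => nth 0 t i) eq_de.
  by rewrite -!tnth_nth !tnth_mktuple.
have dS := diag_mx_perm e s.
exists (invmx Q *m perm_mx s^-1 *m P).
  by rewrite !unitmx_mul unitmx_inv uQ uP unitmx_perm.
have sd : perm_mx s^-1 *m diag_mx d = diag_mx e *m perm_mx s^-1.
  apply: (can_inj (mulKmx (unitmx_perm _ s))).
  rewrite !mulmxA -perm_mxM mulgV perm_mx1 mul1mx dS -eq_de -mulmxA -perm_mxM.
  by rewrite mulgV perm_mx1 mulmx1.
rewrite -[LHS]mulmxA PA mulmxA -(mulmxA (invmx Q) _ (diag_mx d)) sd.
rewrite !mulmxA; congr (_ *m _ *m _).
by apply: (can_inj (mulKmx uQ)); rewrite !mulmxA mulmxV // mul1mx QB mulmxK.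
Qed.

(** Serves to compare multiplicities of eigenvalues. Similarity keeps the rank, and so does the
    passage from [R] to [R[i]]. *)
Lemma symmetric_cospectral_rank (R : rcfType) n (A B : 'M[R]_n) x :
  A^T = A -> B^T = B -> char_poly A = char_poly B ->
  \rank (A - x%:M) = \rank (B - x%:M).
Proof.
move=> symA symB eqAB.
have [P uP PA] := symmetric_cospectral_similar symA symB eqAB.
rewrite -!(mxrank_map (real_complex R)) !map_mxB !map_scalar_mx /=.
set c := real_complex R x.
have E : P *m (map_mx (real_complex R) A - c%:M)
         = (map_mx (real_complex R) B - c%:M) *m P.
  by rewrite mulmxBr mulmxBl PA scalar_mxC.
rewrite -(eqmxMfull _ (_ : row_full P)) ?row_full_unit // E.
by rewrite mxrankMfree // row_free_unit.
Qed.

Lemma symmetric_cospectral_trace (R : rcfType) n (A B : 'M[R]_n) k :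
  A^T = A -> B^T = B -> char_poly A = char_poly B ->
  \tr (A ^+ k) = \tr (B ^+ k).
Proof.
move=> symA symB eqAB.
have [P uP PA] := symmetric_cospectral_similar symA symB eqAB.
have mapX (M : 'M[R]_n) : map_mx (real_complex R) (M ^+ k)
                          = map_mx (real_complex R) M ^+ k.
  elim: k => [|k IH]; first by rewrite !expr0 map_mx1.
  by rewrite !exprS -!mulmxE map_mxM IH.
apply: (@complexI R); rewrite -!trace_map_mx !mapX {mapX}.
set A' := map_mx _ A in PA *; set B' := map_mx _ B in PA *.
have E : P *m A' ^+ k = B' ^+ k *m P.
  elim: k => [|k IH]; first by rewrite !expr0 mulmx1 mul1mx.
  by rewrite !exprS -!mulmxE mulmxA PA -mulmxA IH mulmxA.
by rewrite -(mulKmx uP (A' ^+ k)) E mxtrace_mulC mulmxK.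
Qed.

(** * The recurrence along a path *)

(** Summing the recurrence over [i] telescopes up to boundary terms, which the end conditions
    express through [y 1] and [y n]. *)
Lemma recurrence_boundary_sum (R : realFieldType) (a t s : R) n (y : nat -> R) :
  (forall i, (i < n)%N -> y i + y i.+2 - t * y i.+1 = s) ->
  y 0%N = - a * y 1%N -> y n.+1 = - a * y n -> \sum_(i < n) y i.+1 = s ->
  (1 + a) * (y 1%N + y n) = (2 - t - n%:R) * s.
Proof.
move=> rec y0 yn ys.
have sum_rec m : (m <= n)%N -> m%:R * s
    = (2 - t) * (\sum_(i < m) y i.+1) + y 0%N - y m - y 1%N + y m.+1.
  elim: m => [|m IH] lt_mn; first by rewrite big_ord0; ring.
  rewrite -natr1 mulrDl IH ?(ltnW lt_mn) // big_ord_recr /= mul1r.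
  have := rec m lt_mn; set S := \sum_(_ < _) _; lra.
have := sum_rec n (leqnn n); rewrite ys y0 yn; lra.
Qed.

(* The bilinear form below is the polarization of the first integral
   x_i^2 + x_(i+1)^2 - t x_i x_(i+1) of the homogeneous recurrence;
   y is shifted by the constant solution s / (2 - t). *)
Lemma recurrence_first_integral (R : realFieldType) (t s : R) n (x y : nat -> R) :
  t < 2 ->
  (forall i, (i < n)%N -> x i + x i.+2 - t * x i.+1 = 0) ->
  (forall i, (i < n)%N -> y i + y i.+2 - t * y i.+1 = s) ->
  let w i := y i - s / (2 - t) in
  let Q i := x i * w i + x i.+1 * w i.+1
             - t / 2 * (x i * w i.+1 + x i.+1 * w i) in
  Q n = Q 0%N.
Proof.
move=> t2 recx recy w Q.
have recw i : (i < n)%N -> w i + w i.+2 - t * w i.+1 = 0.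
  move=> lt_in; have <- : y i + y i.+2 - t * y i.+1 - s = 0 by rewrite recy ?subrr.
  by rewrite /w; field; lra.
have const m : (m <= n)%N -> Q m = Q 0%N.
  elim: m => // m IH lt_mn; rewrite -IH ?(ltnW lt_mn) // /Q.
  have -> : x m.+2 = t * x m.+1 - x m by have := recx _ lt_mn; lra.
  have -> : w m.+2 = t * w m.+1 - w m by have := recw _ lt_mn; lra.
  by field.
exact: const.
Qed.

(** As [x] has zero sum, [recurrence_boundary_sum] gives [x n = - x 1]. Equating the first integral
    at both ends and eliminating [y 1 + y n] leaves [x 1 * s] times a factor that is negative for n
    at least 5. *)
Lemma recurrence_first_entry (R : realFieldType) (a t s : R) n (x y : nat -> R) :
  0 <= a -> -1 <= t -> t < 2 -> (4 < n)%N ->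
  (forall i, (i < n)%N -> x i + x i.+2 - t * x i.+1 = 0) ->
  x 0%N = - a * x 1%N -> x n.+1 = - a * x n -> \sum_(i < n) x i.+1 = 0 ->
  (forall i, (i < n)%N -> y i + y i.+2 - t * y i.+1 = s) ->
  y 0%N = - a * y 1%N -> y n.+1 = - a * y n -> \sum_(i < n) y i.+1 = s ->
  x 1%N * s = 0.
Proof.
move=> a0 t1 t2 n5 recx x0 xn xs recy y0 yn ys.
have Ex := recurrence_boundary_sum recx x0 xn xs.
have Ey := recurrence_boundary_sum recy y0 yn ys.
have a1 : 1 + a != 0 by apply/eqP; lra.
have {Ex} xn1 : x n = - x 1%N.
  by move: Ex; rewrite mulr0 => /eqP; rewrite mulf_eq0 (negPf a1) /= => /eqP; lra.
have := recurrence_first_integral t2 recx recy.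
rewrite /= xn yn x0 y0 xn1 => EQ.
have {}EQ : x 1%N * ((y 1%N + y n) * (1 + a ^+ 2 + t * a) - (1 - a) * s) = 0.
  have -> : (1 - a) * s = (1 - a) * (2 - t) * (s / (2 - t)) by field; lra.
  move: EQ; set w := s / (2 - t); lra.
have {Ey}EQ : x 1%N * s * ((2 - t - n%:R) * (1 + a ^+ 2 + t * a) - (1 - a ^+ 2)) = 0.
  rewrite -[RHS](mulr0 (1 + a)) -EQ.
  have -> : (1 + a) * (x 1%N * ((y 1%N + y n) * (1 + a ^+ 2 + t * a) - (1 - a) * s))
    = x 1%N * ((1 + a) * (y 1%N + y n) * (1 + a ^+ 2 + t * a) - (1 - a ^+ 2) * s).
    by ring.
  by rewrite Ey; ring.
move/eqP: EQ; rewrite mulf_eq0 => /orP[/eqP //|/eqP EQ].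
have n5R : 5 <= n%:R :> R by rewrite ler_nat.
(* Both factors are bounded below by their values at t = -1 and n = 5; what remains is a^2 - 2a + 3
   > 0. *)
have k1 : 1 - a + a ^+ 2 <= 1 + a ^+ 2 + t * a by nra.
have k2 : 0 < 1 - a + a ^+ 2 by nra.
have : 2 * (1 - a + a ^+ 2) <= (n%:R + t - 2) * (1 + a ^+ 2 + t * a).
  by apply: ler_pM; lra.
nra.
Qed.

Lemma recurrence_zero (R : realFieldType) (a t : R) n (x : nat -> R) :
  (forall i, (i < n)%N -> x i + x i.+2 - t * x i.+1 = 0) ->
  x 0%N = - a * x 1%N -> x 1%N = 0 -> forall i, (i <= n)%N -> x i = 0.
Proof.
move=> rec x0 x1 i le_in.
have x00 : x 0%N = 0 by rewrite x0 x1 mulr0.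
suff: x i = 0 /\ x i.+1 = 0 by case.
elim: i le_in => // i IH lt_in.
have [xi xi1] := IH (ltnW lt_in); split=> //.
by have := rec i lt_in; rewrite xi xi1; lra.
Qed.

(** * Sums over the neighbours in a path *)

Lemma sum_delta (R : pzRingType) n k (f : nat -> R) :
  \sum_(i < n) (i == k :> nat)%:R * f i = (k < n)%:R * f k.
Proof.
case: ltnP => [lt_kn|le_nk].
  rewrite (bigD1 (Ordinal lt_kn)) //= eqxx big1 ?addr0 // => i ne.
  by move: ne; rewrite -val_eqE /= => /negPf->; rewrite mul0r.
rewrite mul0r big1 // => i _.
by rewrite ltn_eqF ?mul0r // (leq_trans (ltn_ord i)).
Qed.

(** The factor [(0 < j)%:R] discards the second indicator at [j = 0], where the truncated
    predecessor is [0] itself. *)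
Lemma path_relE (R : pzSemiRingType) n (i j : 'I_n) :
  (path_rel i j)%:R = (i == j.+1 :> nat)%:R + (0 < j)%:R * (i == j.-1 :> nat)%:R :> R.
Proof.
rewrite /path_rel -natrM -natrD; congr (_ %:R).
by lia.
Qed.

Lemma sum_path_rel (R : pzRingType) n (j : 'I_n) (f : nat -> R) :
  \sum_(i < n) (path_rel i j)%:R * f i
  = (j.+1 < n)%:R * f j.+1 + (0 < j)%:R * f j.-1.
Proof.
under eq_bigr => i _ do rewrite path_relE mulrDl -mulrA.
rewrite big_split /= -mulr_sumr !sum_delta; congr (_ + _).
by rewrite (leq_ltn_trans (leq_pred _) (ltn_ord j)) mul1r.
Qed.

Lemma vdeg_sum (R : pzSemiRingType) n (e : rel 'I_n) i :
  (vdeg e i)%:R = \sum_j (e i j)%:R :> R.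
Proof.
by rewrite -natr_sum /vdeg -sum1_card big_mkcond.
Qed.

Lemma path_sym n : symmetric (@path_rel n).
Proof. by move=> i j; rewrite /path_rel orbC. Qed.

Lemma path_irrefl n : irreflexive (@path_rel n).
Proof. by move=> i; rewrite /path_rel; lia. Qed.

Lemma vdeg_path (R : pzRingType) n (j : 'I_n) :
  (vdeg (@path_rel n) j)%:R = (j.+1 < n)%:R + (0 < j)%:R :> R.
Proof.
rewrite vdeg_sum; under eq_bigr => i _ do rewrite path_sym -[_%:R]mulr1.
by rewrite (sum_path_rel j (fun=> 1)) !mulr1.
Qed.

(** * Eigenvectors of the path *)

(** This is the matrix X of the overview. On vectors with zero sum it acts as the A_alpha-matrix of
    [e] itself. *)
Definition reduced_mx (R : comNzRingType) (alpha : R) n (e : rel 'I_n) : 'M[R]_n :=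
  Aalpha_mx alpha e - (1 - alpha) *: const_mx 1.

Lemma reduced_mxE (R : comNzRingType) (alpha : R) n (e : rel 'I_n) i j :
  reduced_mx alpha e i j
  = alpha * ((i == j)%:R * (vdeg e i)%:R) + (1 - alpha) * ((e i j)%:R - 1).
Proof. by rewrite !mxE natrM mulrBr addrA. Qed.

Lemma reduced_mx_sym (R : comNzRingType) (alpha : R) n (e : rel 'I_n) :
  symmetric e -> (reduced_mx alpha e)^T = reduced_mx alpha e.
Proof.
move=> sym_e; apply/matrixP => i j; rewrite mxE !reduced_mxE sym_e eq_sym.
by case: eqP => [->|_] //; rewrite !mul0r.
Qed.

Lemma vdeg_compl n (e : rel 'I_n) i : irreflexive e ->
  (vdeg (compl_rel e) i + vdeg e i).+1 = n.
Proof.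
move=> irr_e; have /eqP := cardC (pred_of_simpl [pred j | e i j]).
rewrite card_ord => /eqP En; rewrite -[RHS]En addnC -addnS; congr (_ + _)%N.
rewrite (cardD1 i (predC _)) !inE irr_e add1n; congr _.+1.
by apply: eq_card => j; rewrite !inE /compl_rel eq_sym.
Qed.

(** Adjacency entries of a graph and its complement add up to 1 off the diagonal, and degrees to n -
    1. The scalar is alpha (n - 1) - (1 - alpha), its last term coming from the diagonal of the
    all-ones matrix. *)
Lemma Aalpha_compl (R : comNzRingType) (alpha : R) n (e : rel 'I_n) :
  irreflexive e ->
  Aalpha_mx alpha (compl_rel e) = (alpha * n%:R - 1)%:M - reduced_mx alpha e.
Proof.
move=> irr_e; apply/matrixP => i j; rewrite [RHS]mxE [(- _ : 'M_n) i j]mxE reduced_mxE.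
rewrite !mxE natrM /compl_rel.
have [<-|ne] := eqVneq i j; last first.
  by rewrite /= mul0r mulr0n; case: (e i j) => /=; ring.
rewrite irr_e /= mulr1n.
have -> : n%:R = 1 + (vdeg (compl_rel e) i)%:R + (vdeg e i)%:R :> R.
  by rewrite -{1}(vdeg_compl i irr_e) -natr1 natrD; ring.
by ring.
Qed.

(** A matrix that conjugates [c%:M - A] to [c%:M - B] also conjugates [A] to [B]. *)
Lemma char_poly_reflect (R : rcfType) n c (A B : 'M[R]_n) :
  A^T = A -> B^T = B -> char_poly (c%:M - A) = char_poly (c%:M - B) ->
  char_poly A = char_poly B.
Proof.
move=> symA symB eqAB.
have sym (M : 'M[R]_n) : M^T = M -> (c%:M - M)^T = c%:M - M.
  by move=> symM; rewrite linearB /= tr_scalar_mx symM.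
have [P uP] := symmetric_cospectral_similar (sym _ symA) (sym _ symB) eqAB.
rewrite !map_mxB mulmxBr mulmxBl !map_scalar_mx scalar_mxC => /addrI/oppr_inj PA.
apply: (map_poly_inj (real_complex R)); rewrite !map_char_poly.
exact: char_poly_conj uP PA.
Qed.

Lemma reduced_mx_cospectral (R : rcfType) (alpha : R) n (e1 e2 : rel 'I_n) :
  simple_graph e1 -> simple_graph e2 ->
  same_Aalpha_spectrum alpha (compl_rel e1) (compl_rel e2) ->
  char_poly (reduced_mx alpha e1) = char_poly (reduced_mx alpha e2).
Proof.
move=> [sym1 irr1] [sym2 irr2]; rewrite /same_Aalpha_spectrum.
rewrite (Aalpha_compl alpha irr1) (Aalpha_compl alpha irr2).
by apply: char_poly_reflect; exact: reduced_mx_sym.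
Qed.

Lemma mulmx_reduced (R : comNzRingType) (alpha : R) n (e : rel 'I_n)
    (y : 'rV[R]_n) j : symmetric e ->
  (y *m reduced_mx alpha e) 0 j = alpha * (vdeg e j)%:R * y 0 j
    + (1 - alpha) * (\sum_i (e i j)%:R * y 0 i - \sum_i y 0 i).
Proof.
move=> sym_e; rewrite mxE.
under eq_bigr => i _ do rewrite reduced_mxE.
have -> : alpha * (vdeg e j)%:R * y 0 j
    = \sum_i (i == j)%:R * (alpha * (vdeg e j)%:R * y 0 j).
  rewrite (bigD1 j) //= eqxx mul1r big1 ?addr0 // => i /negPf->.
  by rewrite mul0r.
rewrite -sumrB mulr_sumr -big_split /=; apply: eq_bigr => i _.
by case: eqVneq => [->|_] /=; ring.
Qed.

Section PathKernel.
Variables (R : realFieldType) (alpha t : R) (n : nat).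
Hypotheses (alpha_ge0 : 0 <= alpha) (alpha_lt1 : alpha < 1).
Hypotheses (t_geN1 : -1 <= t) (t_lt2 : t < 2) (n_gt3 : (3 < n)%N).

(** At the eigenvalue [theta], dividing the equation of an inner vertex by 1 - alpha leaves the
    recurrence with coefficient [t] and right-hand side the sum of the entries. An end vertex has
    degree 1 instead of 2; a virtual neighbour with value [- a] times the end entry makes up for the
    missing alpha. *)
Let a := alpha / (1 - alpha).
Let theta := 2 * alpha + (1 - alpha) * t.

(* The entries of y sit at positions 1, ..., n.+1; positions 0 and n.+2 carry
   the virtual values that make the recurrence uniform at the two ends. *)
Let ext (y : 'rV[R]_n.+1) (i : nat) : R :=
  if i == 0%N then - a * y 0 0 else
  if (i <= n.+1)%N then y 0 (inord i.-1) else - a * y 0 ord_max.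

Let in_kernel (y : 'rV[R]_n.+1) :=
  y *m (reduced_mx alpha (@path_rel n.+1) - theta%:M) = 0.

Let ext_ord y (i : 'I_n.+1) : ext y i.+1 = y 0 i.
Proof. by rewrite /ext /= ltn_ord inord_val. Qed.

Let ext0 y : ext y 0 = - a * ext y 1.
Proof. by rewrite (ext_ord y ord0) /ext. Qed.

Let extn y : ext y n.+2 = - a * ext y n.+1.
Proof. by rewrite (ext_ord y ord_max) /ext /= ltnn. Qed.

Let ext_sum y : \sum_(i < n.+1) ext y i.+1 = \sum_i y 0 i.
Proof. by apply: eq_bigr => i _; rewrite ext_ord. Qed.

Let kernel_rec y : in_kernel y -> forall i, (i < n.+1)%N ->
  ext y i + ext y i.+2 - t * ext y i.+1 = \sum_i y 0 i.
Proof.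
rewrite /in_kernel mulmxBr mul_mx_scalar => /subr0_eq Ey i lt_in.
pose j := Ordinal lt_in.
have /rowP/(_ j) := Ey; rewrite mulmx_reduced; last exact: path_sym.
rewrite mxE vdeg_path.
have -> : \sum_i (path_rel i j)%:R * y 0 i
    = (j.+1 < n.+1)%:R * ext y j.+2 + (0 < j)%:R * ext y j.-1.+1.
  rewrite -(sum_path_rel j (fun k => ext y k.+1)).
  by apply: eq_bigr => k _; rewrite ext_ord.
have [b0 a0] : 1 - alpha != 0 /\ alpha = a * (1 - alpha).
  have b0 : 1 - alpha != 0 by rewrite subr_eq0 gt_eqF.
  by split=> //; rewrite /a divfK.
have aY Y : a * (1 - alpha) * Y = alpha * Y by rewrite -a0.
have ji : nat_of_ord j = i by [].
rewrite -(ext_ord y j) /theta ji.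
set s := \sum_i _; move=> E; apply: (mulfI b0).
(* The vertex is first, last or inner; a missing neighbour is replaced by its virtual value through
   [ext0] or [extn]. *)
have : i = 0%N \/ (0 < i)%N by case: (i); [left|right].
have : i.+1 = n.+1 \/ (i.+1 < n.+1)%N.
  by have := lt_in; rewrite leq_eqVlt => /orP[/eqP|]; [left | right].
case=> [[ein]|lt1] [ei0|lt0]; move: E.
- by exfalso; lia.
- rewrite lt0 prednK // ein extn ltnn /= => E.
  by move: E (aY (ext y n.+1)); lra.
- rewrite lt1 ei0 ext0 /= => E.
  by move: E (aY (ext y 1)); lra.
- by rewrite lt1 lt0 prednK //=; lra.
Qed.

(** With zero sum the recurrence is homogeneous and starts from two zeros. By linearity, a kernel
    vector is determined by its sum and its first entry. *)
Let kernel_zero y : in_kernel y -> \sum_i y 0 i = 0 -> y 0 0 = 0 -> y = 0.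
Proof.
move=> ky sy y0; apply/rowP => i; rewrite mxE -ext_ord.
apply: (@recurrence_zero R a t n.+1) (ltn_ord i) => //.
  by move=> k lt_kn; rewrite kernel_rec.
by rewrite (ext_ord y ord0).
Qed.

Let kernel_first x y : in_kernel x -> in_kernel y -> \sum_i x 0 i = 0 ->
  x 0 0 * \sum_i y 0 i = 0.
Proof.
move=> kx ky sx; rewrite -[x 0 0](ext_ord x ord0).
apply: (@recurrence_first_entry R a t _ n.+1 (ext x) (ext y)) => //.
- by rewrite /a divr_ge0 // subr_ge0 ltW.
- by move=> i lt_in; rewrite kernel_rec.
- by rewrite ext_sum.
- exact: kernel_rec.
Qed.

Let in_kernel_lin c x y : in_kernel x -> in_kernel y -> in_kernel (x - c *: y).
Proof.
by rewrite /in_kernel => kx ky; rewrite mulmxBl -scalemxAl kx ky scaler0 subr0.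
Qed.

Let sum_lin c (x y : 'rV[R]_n.+1) :
  \sum_i (x - c *: y) 0 i = \sum_i x 0 i - c * \sum_i y 0 i.
Proof.
by rewrite mulr_sumr -sumrB; apply: eq_bigr => i _; rewrite !mxE.
Qed.

(** By [kernel_zero] it is enough to cancel the sum and the first entry of [y - c *: x]. If [x] has
    zero sum, its first entry is nonzero and fixes [c], and [kernel_first] makes the sum of [y]
    vanish. Otherwise the sums fix [c], and [kernel_first] makes the first entry vanish. *)
Lemma path_kernel_line x y : in_kernel x -> in_kernel y -> x != 0 ->
  exists c, y = c *: x.
Proof.
move=> kx ky nzx.
suff [c sc c0] : exists2 c, \sum_i (y - c *: x) 0 i = 0 & (y - c *: x) 0 0 = 0.
  by exists c; apply/subr0_eq/kernel_zero => //; exact: in_kernel_lin.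
have [sx0|sx] := eqVneq (\sum_i x 0 i) 0.
  have nzx0 : x 0 0 != 0 by apply: contra_neq nzx => /(kernel_zero kx); exact.
  exists (y 0 0 / x 0 0); last by rewrite !mxE divfK ?subrr.
  rewrite sum_lin sx0 mulr0 subr0.
  by have /eqP := kernel_first kx ky sx0; rewrite mulf_eq0 (negPf nzx0) => /eqP.
exists ((\sum_i y 0 i) / \sum_i x 0 i); first by rewrite sum_lin divfK ?subrr.
have kz := in_kernel_lin ((\sum_i y 0 i) / \sum_i x 0 i) ky kx.
have sz : \sum_i (y - (\sum_i y 0 i) / (\sum_i x 0 i) *: x) 0 i = 0.
  by rewrite sum_lin divfK ?subrr.
by have /eqP := kernel_first kz kx sz; rewrite mulf_eq0 (negPf sx) orbF => /eqP.
Qed.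

Lemma path_reduced_rank :
  (n <= \rank (reduced_mx alpha (@path_rel n.+1)
             - (2 * alpha + (1 - alpha) * t)%:M)%R)%N.
Proof.
rewrite -/theta; set N := _ - _; rewrite leqNgt; apply/negP => ltn.
have rk : (1 < \rank (kermx N))%N by rewrite mxrank_ker; lia.
have [x kx nzx] : exists2 x, in_kernel x & x != 0.
  exists (nz_row (kermx N)); first by apply/sub_kermxP; exact: nz_row_sub.
  by rewrite nz_row_eq0 -mxrank_eq0; lia.
have : (kermx N <= x)%MS.
  apply/row_subP => i; have [|c ->] := @path_kernel_line x (row i (kermx N)) kx _ nzx.
    by apply/sub_kermxP; exact: row_sub.
  exact: scalemx_sub.
by move/mxrankS; rewrite rank_rV nzx; lia.
Qed.
End PathKernel.

(** * Eigenvectors of a cycle component *)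

(** Here [j] ranges over all vertices, so no edge leaves the image of [v]. Indices are cyclic. *)
Definition cycle_component n (e : rel 'I_n) s (v : 'I_s -> 'I_n) : Prop :=
  injective v /\
  forall i j, e (v i) j = (j == v (ordS i)) || (j == v (ord_pred i)).

Lemma ordS_neq_pred s (i : 'I_s) : (2 < s)%N -> ordS i != ord_pred i.
Proof.
move=> s_gt2; rewrite -val_eqE /=; apply/negP => /eqP.
have : (i < s)%N := ltn_ord i.
have [->|i0] := posnP i.
  rewrite add0n modn_small; last by lia.
  by rewrite modn_small; lia.
move=> lt_is; have -> : ((i + s).-1 = i.-1 + s)%N by lia.
rewrite modnDr (@modn_small i.-1); last by lia.
 have [E|ne] := eqVneq i.+1 s; first by rewrite E modnn; lia.
by rewrite modn_small; lia.
Qed.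

Section CycleKernel.
Variables (F : fieldType) (alpha : F) (n : nat) (e : rel 'I_n).
Variables (s : nat) (v : 'I_s -> 'I_n).
Hypotheses (sym_e : symmetric e) (s_gt2 : (2 < s)%N).
Hypothesis cyc_v : cycle_component e v.

Let edge_v (k : 'I_s) j :
  (e (v k) j)%:R = (j == v (ordS k))%:R + (j == v (ord_pred k))%:R :> F.
Proof.
have [inj_v ->] := cyc_v; have /negPf ne := ordS_neq_pred k s_gt2.
case: (eqVneq j (v (ordS k))) => [->|_]; last by rewrite add0r.
by rewrite (inj_eq inj_v) ne addr0.
Qed.

Let vdeg_v k : (vdeg e (v k))%:R = 2 :> F.
Proof.
rewrite vdeg_sum; under eq_bigr => j _ do rewrite edge_v.
have one (u : 'I_n) : \sum_j (j == u)%:R = 1 :> F.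
  rewrite (bigD1 u) //= eqxx big1 ?addr0 // => j /negPf-> //.
by rewrite big_split /= !one.
Qed.

(** The sum over [k] extends the powers of [z] by zero off the cycle without inverting [v]. *)
Let wave (z : F) : 'rV[F]_n := \row_j \sum_(k < s) z ^+ k * (j == v k)%:R.

Let expr_mod (z : F) m : z ^+ s = 1 -> z ^+ (m %% s) = z ^+ m.
Proof.
by move=> zs; rewrite [in RHS](divn_eq m s) exprD mulnC exprM zs expr1n mul1r.
Qed.

Let wave_sum (z : F) : z ^+ s = 1 -> z != 1 -> \sum_j wave z 0 j = 0.
Proof.
move=> zs z1; under eq_bigr => j _ do rewrite mxE.
rewrite exchange_big /=.
have -> : \sum_(k < s) \sum_j z ^+ k * (j == v k)%:R = \sum_(k < s) z ^+ k.
  apply: eq_bigr => k _; rewrite (bigD1 (v k)) //= eqxx mulr1 big1 ?addr0 //.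
  by move=> j /negPf->; rewrite mulr0.
have := subrX1 z s; rewrite zs subrr => /esym/eqP.
by rewrite mulf_eq0 subr_eq0 (negPf z1) => /eqP.
Qed.

(** The all-ones matrix kills the wave, whose entries sum to zero. Cycle vertices have degree 2, and
    a step along the cycle multiplies by [z] or [z^-1]; [z ^+ s = 1] takes care of the
    wrap-around. *)
Let wave_kernel (z : F) : z ^+ s = 1 -> z != 1 ->
  wave z *m (reduced_mx alpha e
             - (2 * alpha + (1 - alpha) * (z + z^-1))%:M) = 0.
Proof.
move=> zs z1; apply/eqP; rewrite mulmxBr mul_mx_scalar subr_eq0; apply/eqP.
have z0 : z != 0.
  by apply: contraNneq (oner_neq0 F) => z0; rewrite -zs z0 expr0n; case: (s) s_gt2.
apply/rowP => j; rewrite mulmx_reduced // wave_sum // subr0 [RHS]mxE [RHS]mulrDl.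
congr (_ + _).
  rewrite !mxE !mulr_sumr; apply: eq_bigr => k _.
  case: eqVneq => [->|_]; last by rewrite !mulr0.
  by rewrite vdeg_v !mulr1 (mulrC 2).
rewrite -mulrA; congr (_ * _).
under eq_bigr => i _ do rewrite mxE mulr_sumr.
rewrite exchange_big /=.
transitivity (\sum_(k < s) z ^+ k * (e (v k) j)%:R).
  apply: eq_bigr => k _; rewrite (bigD1 (v k)) //= eqxx mulr1 mulrC big1 ?addr0 //.
  by move=> i /negPf->; rewrite !mulr0.
under eq_bigr => k _ do rewrite edge_v mulrDr.
rewrite big_split /= mxE addrC mulrDl !mulr_sumr; congr (_ + _).
  rewrite (reindex_inj (can_inj (@ordSK s))) /=.
  apply: eq_bigr => k _; rewrite ordSK expr_mod // exprS mulrA //.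
rewrite (reindex_inj (can_inj (@ord_predK s))) /=.
apply: eq_bigr => k _; rewrite ord_predK expr_mod // mulrA; congr (_ * _).
apply: (mulfI z0); rewrite mulVKf // -exprS prednK ?exprD ?zs ?mulr1 //.
by rewrite addn_gt0 (leq_trans _ s_gt2) ?orbT.
Qed.

Let wave_v z (k : 'I_s) : wave z 0 (v k) = z ^+ k.
Proof.
have [inj_v _] := cyc_v; rewrite mxE (bigD1 k) //= eqxx mulr1 big1 ?addr0 // => l.
by rewrite (inj_eq inj_v) eq_sym => /negPf->; rewrite mulr0.
Qed.

(** The waves of [z] and [z^-1] lie in the kernel. Were they proportional, their entries at
    positions 0 and 1 would give [z = z^-1]. *)
Lemma cycle_reduced_rank (z : F) : z ^+ s = 1 -> z ^+ 2 != 1 ->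
  (\rank (reduced_mx alpha e - (2 * alpha + (1 - alpha) * (z + z^-1))%:M)%R + 2 <= n)%N.
Proof.
move=> zs z2; set N := _ - _.
have z1 : z != 1 by apply: contraNneq z2 => ->; rewrite expr1n.
have z0 : z != 0.
  by apply: contraNneq (oner_neq0 F) => z0; rewrite -zs z0 expr0n; case: (s) s_gt2.
have k1 : (wave z <= kermx N)%MS by apply/sub_kermxP; exact: wave_kernel.
have k2 : (wave z^-1 <= kermx N)%MS.
  apply/sub_kermxP; rewrite /N.
  have -> : z + z^-1 = z^-1 + z^-1^-1 by rewrite invrK addrC.
  apply: wave_kernel.
    by rewrite exprVn zs invr1.
  by rewrite invr_eq1.
have lt0s : (0 < s)%N by lia.
have lt1s : (1 < s)%N by lia.
have rk1 : \rank (wave z) = 1%N.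
  rewrite rank_rV; case: eqP => // /rowP/(_ (v (Ordinal lt0s))).
  by rewrite wave_v mxE expr0 => /eqP; rewrite oner_eq0.
suff : (1 < \rank (kermx N))%N by rewrite mxrank_ker; lia.
rewrite ltnNge; apply/negP => le1.
have sub : (kermx N <= wave z)%MS by rewrite -(geq_leqif (mxrank_leqif_sup k1)) rk1.
have /sub_rVP[c /rowP Ec] : (wave z^-1 <= wave z)%MS := submx_trans k2 sub.
have := Ec (v (Ordinal lt0s)); rewrite [RHS]mxE !wave_v !expr0 mulr1 => Ec1.
have := Ec (v (Ordinal lt1s)); rewrite [RHS]mxE !wave_v -Ec1 mul1r !expr1 => Ez.
by case/eqP: z2; rewrite expr2 -{1}Ez mulVf.
Qed.
End CycleKernel.

(** * Roots of unity with bounded real part *)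

Lemma unity_root_nontrivial (C : numClosedFieldType) m : (1 < m)%N ->
  exists2 z : C, z ^+ m = 1 & z != 1.
Proof.
(* A root of 1 + X + ... + X^(m-1) is an m-th root of unity; it is not 1, where the value is m. *)
move=> m1; pose p : {poly C} := \poly_(i < m) 1.
have /closed_rootP[z] : size p != 1%N.
  by rewrite size_poly_eq ?oner_eq0 //; lia.
rewrite /root horner_poly => /eqP.
under eq_bigr => i _ do rewrite mul1r; move=> Ez.
exists z; first by apply/eqP; rewrite -subr_eq0 subrX1 Ez mulr0.
apply: contra_eq_neq Ez => ->; under eq_bigr => i _ do rewrite expr1n.
by rewrite sumr_const card_ord pnatr_eq0; lia.
Qed.

(** For odd s, [z ^+ 2 = 1] would force [z = 1]. For even s, a square root of a nontrivial root of
    unity of order dividing s/2 will do. *)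
Lemma unity_root_nonreal (C : numClosedFieldType) s : (2 < s)%N ->
  exists2 z : C, z ^+ s = 1 & z ^+ 2 != 1.
Proof.
move=> s2; have [odd_s|even_s] := boolP (odd s).
  have [z zs z1] := @unity_root_nontrivial C s (ltnW s2).
  exists z => //; apply: contraNneq z1 => z2.
  by rewrite -zs -[s]odd_double_half odd_s exprS -mul2n exprM z2 expr1n mulr1.
have s_half : s = (2 * s./2)%N.
  by rewrite mul2n -[LHS]odd_double_half (negPf even_s).
have [z zs z1] := @unity_root_nontrivial C s./2 ltac:(lia).
by exists (sqrtC z); rewrite ?sqrtCK // s_half exprM sqrtCK.
Qed.

(** On the unit circle [z + z^-1] is twice the real part, strictly between -2 and 2 for nonreal [z].
    If this value t is below -1, then [z] is replaced by its square, with value t^2 - 2 > -1; the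
    square of [z] is not -1, as that would give t = 0. *)
Lemma unity_root_real_part (R : rcfType) s : (2 < s)%N ->
  exists (z : R[i]) (t : R), [/\ z ^+ s = 1, z ^+ 2 != 1,
    z + z^-1 = real_complex R t & -1 <= t < 2].
Proof.
move=> s2; have [z zs z2] := @unity_root_nonreal R[i] s s2.
have aux (w : R[i]) : w ^+ s = 1 -> w ^+ 2 != 1 -> exists2 t : R,
    w + w^-1 = real_complex R t & -2 < t < 2.
  move=> ws w2; have w1 : `|w| = 1.
    apply/eqP; rewrite -(@pexpr_eq1 _ _ s) ?normr_ge0 //; last by lia.
    by rewrite -normrX ws normr1.
  exists (2 * complex.Re w).
    by rewrite invc_norm w1 expr1n invr1 mul1r addcJ rmorphM rmorph_nat.
  have : (complex.Re w) ^+ 2 + (complex.Im w) ^+ 2 = 1.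
    by apply: (@complexI R); rewrite add_Re2_Im2 w1 expr1n.
  have : complex.Im w != 0.
    apply: contraNneq w2 => im0; apply/eqP; have := add_Re2_Im2 w.
    rewrite im0 w1 expr1n expr0n addr0 => <-.
    by rewrite {1}[w]complexE im0 rmorph0 mulr0 addr0 rmorphXn.
  case: w {ws w2 w1} => x y /= y0 E.
  have y2 : 0 < y ^+ 2 by rewrite exprn_even_gt0.
  by apply/andP; split; nra.
have [t Et /andP[t1 t2]] := aux z zs z2.
have z0 : z != 0.
  by apply: contraNneq (oner_neq0 R[i]) => z0; rewrite -zs z0 expr0n; case: (s) s2.
have [t1'|t1'] := leP (-1) t; first by exists z, t; split; rewrite ?t1'.
exists (z ^+ 2), (t ^+ 2 - 2); split.
- by rewrite exprAC zs expr1n.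
- rewrite -exprM; apply/negP => /eqP z4.
  have : (z ^+ 2 - 1) * (z ^+ 2 + 1) = 0 by rewrite -subr_sqr -exprM z4 expr1n subrr.
  move/eqP; rewrite mulf_eq0 subr_eq0 (negPf z2) /= => /eqP zz.
  have : z * (z + z^-1) = 0 by rewrite mulrDr divff.
  move/eqP; rewrite mulf_eq0 (negPf z0) Et /= (fmorph_eq0 (real_complex R)) => /eqP.
  by lra.
- rewrite rmorphB rmorphXn /= -Et rmorph_nat; field; exact: z0.
- by apply/andP; split; nra.
Qed.

(** The eigenvalue of the complex waves is real, so the rank bound descends from [R[i]] to [R]. *)
Lemma cycle_reduced_corank (R : rcfType) (alpha : R) n (e : rel 'I_n) s
    (v : 'I_s -> 'I_n) :
  symmetric e -> (2 < s)%N -> cycle_component e v ->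
  exists2 t : R, -1 <= t < 2 &
    (\rank (reduced_mx alpha e - (2 * alpha + (1 - alpha) * t)%:M)%R + 2 <= n)%N.
Proof.
move=> sym_e s2 cyc; have [z [t [zs z2 Et tb]]] := unity_root_real_part R s2.
exists t => //; have := cycle_reduced_rank (real_complex R alpha) sym_e s2 cyc zs z2.
rewrite Et -(mxrank_map (real_complex R)) map_mxB map_scalar_mx /=.
have -> : real_complex R (2 * alpha + (1 - alpha) * t) = 2 * real_complex R alpha
    + (1 - real_complex R alpha) * real_complex R t.
  by rewrite rmorphD !rmorphM rmorphB rmorph1 rmorph_nat.
have -> // : map_mx (real_complex R) (reduced_mx alpha e)
    = reduced_mx (real_complex R alpha) e.
apply/matrixP => i j; rewrite [LHS]mxE !reduced_mxE.
by rewrite !(rmorphD, rmorphM, rmorphN, rmorph1, rmorph_nat).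
Qed.

(** * Graphs with all degrees 1 or 2 *)

Section Neighbours.
Variables (n : nat) (e : rel 'I_n).

Lemma vdeg1_neighbour u a z : vdeg e u = 1%N -> e u a -> e u z -> z = a.
Proof.
move=> /eqP; rewrite /vdeg => d1 ua uz; apply/eqP.
have /card_le1_eqP E : (#|[pred j | e u j]| <= 1)%N by rewrite (eqP d1).
by apply/eqP/E; rewrite inE.
Qed.

Lemma vdeg2_neighbour u a b z :
  (vdeg e u <= 2)%N -> e u a -> e u b -> a != b -> e u z -> z = a \/ z = b.
Proof.
move=> d2 ua ub ab uz.
have [->|za] := eqVneq z a; first by left.
have [->|zb] := eqVneq z b; first by right.
suff : (#|z |: [set a; b]| <= 2)%N by rewrite cardsU1 cards2 !inE negb_or za zb ab.
apply: leq_trans d2; apply: subset_leq_card; apply/subsetP => j.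
by rewrite !inE => /or3P[] /eqP->.
Qed.

Lemma vdeg_le1 u a : (forall z, e u z -> z = a) -> (vdeg e u <= 1)%N.
Proof.
move=> H; apply/card_le1_eqP => i j; rewrite !inE => /H-> /H-> //.
Qed.

(** The path is extended greedily at its far end. [k] bounds the steps left: at [k = 0] the path
    would have more than [n] distinct vertices. *)
Lemma exists_maximal_path x : exists p,
  [/\ path e x p, uniq (x :: p) & forall z, e (last x p) z -> z \in x :: p].
Proof.
suff ext k p : (n <= size p + k)%N -> path e x p -> uniq (x :: p) -> exists q,
    [/\ path e x q, uniq (x :: q) & forall z, e (last x q) z -> z \in x :: q].
  exact: (ext n [::]).
elim: k p => [|k IH] p.
  rewrite addn0 => le_np _ /card_uniqP E; have := max_card (mem (x :: p)).
  by rewrite E card_ord /=; lia.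
move=> le_n pth unq.
have [/existsP[z /andP[ez zp]]|] := boolP [exists z, e (last x p) z && (z \notin x :: p)].
  apply: (IH (rcons p z)); first by rewrite size_rcons; lia.
    by rewrite rcons_path pth.
  by rewrite -rcons_cons rcons_uniq zp.
rewrite negb_exists => /forallP max_p; exists p; split=> // z ez.
by have := max_p z; rewrite ez negbK.
Qed.
End Neighbours.

Section MaximalPath.
Variables (n : nat) (e : rel 'I_n).
Hypotheses (sym_e : symmetric e) (irr_e : irreflexive e).
Hypothesis deg_le2 : forall u, (vdeg e u <= 2)%N.
Variables (x : 'I_n) (p : seq 'I_n).
Hypotheses (path_p : path e x p) (uniq_p : uniq (x :: p)).
Hypothesis max_p : forall z, e (last x p) z -> z \in x :: p.

Let c i := nth x (x :: p) i.

Lemma maximal_path_inj i j : (i <= size p)%N -> (j <= size p)%N -> c i = c j -> i = j.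
Proof. by move=> ip jp /eqP; rewrite /c nth_uniq // => /eqP. Qed.

Lemma maximal_path_edge i : (i < size p)%N -> e (c i) (c i.+1).
Proof. by move=> lt_ip; apply: (pathP x path_p). Qed.

Lemma maximal_path_interior i z : (0 < i < size p)%N -> e (c i) z ->
  z = c i.-1 \/ z = c i.+1.
Proof.
move=> /andP[i0 ip]; apply: vdeg2_neighbour => //.
- by rewrite sym_e -{2}(prednK i0); apply: maximal_path_edge; lia.
- exact: maximal_path_edge.
- by apply/eqP => /maximal_path_inj; lia.
Qed.

(** By maximality [z] lies on the path, and an inner vertex already has its two neighbours there. So
    the path either stops or closes up at [x]. *)
Lemma maximal_path_last z : (0 < size p)%N -> e (c (size p)) z ->
  z = c (size p).-1 \/ z = x.
Proof.
move=> p0 ez; have : z \in x :: p.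
  by apply: max_p; rewrite (last_nth x).
case/(nthP x) => i; rewrite /= ltnS -/(nth x (x :: p) i) -/(c i) => ip zi.
have [i0|i0] := posnP i; first by right; rewrite -zi i0.
have [ilt|ige] := ltnP i (size p); last first.
  by move: ez; rewrite -zi; have -> : i = size p by [lia]; rewrite irr_e.
left; rewrite -zi; move: ez; rewrite -zi sym_e.
case/(maximal_path_interior (i := i)); rewrite ?i0 //.
  by move/maximal_path_inj => E; have := E (leqnn _); lia.
by move/maximal_path_inj => E; rewrite (E (leqnn _) ilt).
Qed.
End MaximalPath.

(** The degree sum leaves exactly two vertices of degree 1. A maximal path from one of them ends at
    the other and is a component. If it misses a vertex [w], all outside degrees are 2, and a
    maximal path from [w] closes up to a cycle. *)
Lemma path_or_cycle n (e : rel 'I_n) : simple_graph e ->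
  (forall u, (0 < vdeg e u <= 2)%N) -> (\sum_u vdeg e u + 2 = 2 * n)%N ->
  graph_iso e (@path_rel n) \/
  exists s (v : 'I_s -> 'I_n), [/\ (2 < s)%N, (s + 2 <= n)%N & cycle_component e v].
Proof.
move=> [sym_e irr_e] deg sum_deg.
have deg2 u : (vdeg e u <= 2)%N by case/andP: (deg u).
have ends2 : #|[pred u | vdeg e u == 1%N]| = 2%N.
  rewrite -sum1_card big_mkcond /=.
  suff : (\sum_u vdeg e u + \sum_(u < n) (if vdeg e u == 1%N then 1 else 0) = 2 * n)%N.
    set S1 := (\sum_u vdeg e u)%N in sum_deg *; move=> E.
    by apply: (@addnI S1); rewrite sum_deg -E; congr addn; apply: eq_bigr.
  rewrite -big_split /= (eq_bigr (fun=> 2%N)); last first.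
    by move=> u _; have := deg u; case: (vdeg e u) => [|[|[|]]].
  by rewrite sum_nat_const card_ord mulnC.
have [x dx] : exists x, vdeg e x = 1%N.
  have /card_gt0P[x] : (0 < #|[pred u | vdeg e u == 1%N]|)%N by rewrite ends2.
  by rewrite inE => /eqP; exists x.
have [p [path_p uniq_p max_p]] := exists_maximal_path e x.
have edge_p := maximal_path_edge path_p.
have inj_p := maximal_path_inj uniq_p.
have int_p := maximal_path_interior sym_e deg2 path_p uniq_p.
have last_p := maximal_path_last sym_e irr_e deg2 path_p uniq_p max_p.
move: edge_p inj_p int_p last_p; set c := fun i => nth x (x :: p) i.
move=> edge_p inj_p int_p last_p.
have p0 : (0 < size p)%N.
  have /card_gt0P[z] : (0 < vdeg e x)%N by rewrite dx.
  rewrite inE => xz; case: (p) max_p => //= H.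
  by have := H z xz; rewrite inE => /eqP zx; move: xz; rewrite zx irr_e.
have first_p z : e x z -> z = c 1%N.
  by move=> xz; apply: vdeg1_neighbour dx _ xz; exact: (edge_p 0%N p0).
(* If the last vertex is adjacent to [x], the path is a single edge, and [x] is the predecessor
   anyway. *)
have {}last_p z : e (c (size p)) z -> z = c (size p).-1.
  move=> yz; case: (last_p z p0 yz) => // zx.
  move: yz; rewrite zx sym_e => /first_p/inj_p E.
  by rewrite (E (leqnn _) p0).
have dy : vdeg e (c (size p)) = 1%N.
  apply/eqP; rewrite eqn_leq (vdeg_le1 last_p).
  by case/andP: (deg (c (size p))).
have xy : x != c (size p).
  by apply/eqP => /(inj_p 0%N _ (leq0n _) (leqnn _)) E; rewrite -E in p0.
have nbr_p i z : (i <= size p)%N -> e (c i) z ->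
    exists2 j, (j <= size p)%N & z = c j /\ ((i.+1 == j) || (j.+1 == i)).
  move=> ip; have [->|i0] := posnP i; first by move/first_p->; exists 1%N.
  have [ilt|ige] := ltnP i (size p); last first.
    have -> : i = size p by lia.
    by move/last_p->; exists (size p).-1; [lia | split; [|lia]].
  case/int_p; rewrite ?i0 // => ->.
    by exists i.-1; [lia | split; [|lia]].
  by exists i.+1; [lia | split; [|lia]].
have memc u : u \in x :: p -> exists2 i, (i <= size p)%N & u = c i.
  by case/(nthP x) => i ip <-; exists i.
have cmem i : (i <= size p)%N -> c i \in x :: p.
  by move=> ip; apply: mem_nth.
have closed u z : e u z -> (u \in x :: p) = (z \in x :: p).
  have imp a b : e a b -> a \in x :: p -> b \in x :: p.
    by move=> ab /memc[i ip Ea]; move: ab; rewrite Ea => /nbr_p[] // j jp [-> _]; apply: cmem.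
  by move=> uz; apply/idP/idP; apply: imp; rewrite // sym_e.
have [all_p|] := boolP [forall u, u \in x :: p].
  left; have size_p : size (x :: p) = n.
    rewrite -(card_uniqP uniq_p) -[RHS]card_ord; apply: eq_card => u.
    by rewrite (forallP all_p).
  (* The isomorphism sends a vertex to its position along the path. *)
  pose f (u : 'I_n) : 'I_n := cast_ord size_p
    (Ordinal (etrans (index_mem u (x :: p)) (forallP all_p u))).
  have cf u : c (f u) = u by rewrite /c /= nth_index // (forallP all_p).
  have fle u : (f u <= size p)%N by rewrite -ltnS -[(size p).+1]/(size (x :: p)) size_p.
  exists f; split.
    apply: injF_bij => u w fuw; by rewrite -(cf u) -(cf w) fuw.
  move=> u w; rewrite /path_rel; apply/idP/idP => [uw|].
    rewrite -{1}(cf u) in uw; have [j jp [Ej Hj]] := nbr_p _ _ (fle u) uw.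
    suff -> : nat_of_ord (f w) = j by [].
    by apply: inj_p => //; exact: etrans (cf w) Ej.
  case/orP => /eqP E; rewrite -(cf u) -(cf w) -E; last rewrite sym_e.
    by apply: edge_p; rewrite E.
  by apply: edge_p; rewrite E.
rewrite negb_forall => /existsP[w wp]; right.
(* A vertex of degree 1 off the path would be a third one, besides the two ends. *)
have deg_out u : u \notin x :: p -> vdeg e u = 2%N.
  move=> up; suff : vdeg e u != 1%N by have := deg u; case: (vdeg e u) => [|[|[|]]].
  apply/negP => du.
  have : (#|u |: [set x; c (size p)]| <= 2)%N.
    rewrite -ends2; apply: subset_leq_card; apply/subsetP => z.
    by rewrite !inE => /or3P[] /eqP->; rewrite ?du ?dx ?dy.
  rewrite cardsU1 cards2 !inE negb_or xy.
  have -> : u != x by apply: contraNneq up => ->; rewrite inE eqxx.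
  by have -> : u != c (size p) by apply: contraNneq up => ->; rewrite cmem.
have [q [path_q uniq_q max_q]] := exists_maximal_path e w.
have out_q u : u \in w :: q -> u \notin x :: p.
  move=> uq; have : u \in [seq u <- w :: q | u \notin x :: p].
    rewrite (_ : [seq _ <- _ | _] = w :: q) //; apply/all_filterP.
    rewrite /= wp /=; elim: q (w) wp path_q {uniq_q max_q uq} => //= b q IH a ap.
    case/andP=> ab pq; have bp : b \notin x :: p by rewrite -(closed _ _ ab).
    by rewrite bp; apply: IH pq.
  by rewrite mem_filter => /andP[].
have edge_q := maximal_path_edge path_q.
have inj_q := maximal_path_inj uniq_q.
have last_q := maximal_path_last sym_e irr_e deg2 path_q uniq_q max_q.
move: edge_q inj_q last_q; set d := fun i => nth w (w :: q) i => edge_q inj_q last_q.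
have deg_d i : (i <= size q)%N -> vdeg e (d i) = 2%N.
  by move=> iq; apply/deg_out/out_q/mem_nth.
have q0 : (0 < size q)%N.
  have /card_gt0P[z] : (0 < vdeg e w)%N by case/andP: (deg w).
  rewrite inE => xz; case: (q) max_q => //= H.
  by have := H z xz; rewrite inE => /eqP zx; move: xz; rewrite zx irr_e.
have q1 : (1 < size q)%N.
  rewrite ltnNge; apply/negP => q1; have E : size q = 1%N by lia.
  have : (vdeg e (d (size q)) <= 1)%N.
    by apply: (@vdeg_le1 _ _ _ w) => z /(last_q z q0); rewrite E => -[].
  by rewrite deg_d.
(* Without this closing edge the last vertex would have degree at most 1. *)
have back : e (d (size q)) w.
  apply: contraT => nback.
  have : (vdeg e (d (size q)) <= 1)%N.
    apply: (@vdeg_le1 _ _ _ (d (size q).-1)) => z ez.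
    by case: (last_q z q0 ez) => // zw; rewrite -zw ez in nback.
  by rewrite deg_d.
exists (size q).+1, (fun i => d i).
have inj_d : injective (fun i : 'I_(size q).+1 => d i).
  by move=> i j /inj_q E; apply/val_inj/E; rewrite -ltnS.
have edgeS (i : 'I_(size q).+1) : e (d i) (d (ordS i)).
  rewrite /=; have := ltn_ord i; rewrite ltnS leq_eqVlt => /orP[/eqP E|lt].
    by rewrite E modnn.
  by rewrite modn_small //; apply: edge_q.
split; first by [].
  (* The cycle is disjoint from the first path, which has at least two vertices. *)
  have : uniq ((x :: p) ++ w :: q).
    rewrite cat_uniq uniq_p uniq_q andbT andTb; apply/hasPn => u uq.
    by apply: out_q.
  move/card_uniqP; rewrite size_cat /= => E.
  have := max_card (mem ((x :: p) ++ w :: q)); rewrite E card_ord /=; lia.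
split=> // i j.
have eS := edgeS i.
have eP : e (d i) (d (ord_pred i)) by have := edgeS (ord_pred i); rewrite ord_predK sym_e.
have neSP : d (ordS i) != d (ord_pred i).
  by rewrite (inj_eq inj_d) ordS_neq_pred.
apply/idP/orP => [|[] /eqP-> //].
by case/(vdeg2_neighbour (deg2 _) eS eP neSP) => ->; [left | right].
Qed.

(** * Moments *)

Section Moments.
Variables (R : realFieldType) (n : nat) (e : rel 'I_n).
Hypotheses (sym_e : symmetric e) (irr_e : irreflexive e).

Definition common (i j : 'I_n) : nat := #|[pred k | e i k && e k j]|.

Local Notation a i j := ((e i j)%:R : R).
Local Notation d i := ((vdeg e i)%:R : R).
Local Notation p i j := ((common i j)%:R : R).
Definition deg_sum : R := \sum_i d i.
Definition deg_sqsum : R := \sum_i d i ^+ 2.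
(** For a simple graph with adjacency matrix A, this is the trace of A^3, six times the number of
    triangles. Then [walk3_sum] is the number of walks of length 3 and [walk2_sqsum] the trace of
    A^4. *)
Definition triangle_sum : R := \sum_i \sum_j p i j * a i j.
Definition walk3_sum : R := \sum_i \sum_j a i j * (d i * d j).
Definition walk2_sqsum : R := \sum_i \sum_j p i j ^+ 2.

Lemma commonE i j : p i j = \sum_k a i k * a k j.
Proof.
rewrite /common -sum1_card big_mkcond natr_sum.
by apply: eq_bigr => k _; rewrite inE -natrM mulnb; case: (_ && _).
Qed.

Lemma sum_edge i : \sum_j a i j = d i.
Proof. by rewrite vdeg_sum. Qed.

Lemma sum_edge_r j : \sum_i a i j = d j.
Proof. by rewrite -sum_edge; apply: eq_bigr => i _; rewrite sym_e. Qed.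

Lemma sum_common i : \sum_j p i j = \sum_k a i k * d k.
Proof.
under eq_bigr => j _ do rewrite commonE.
by rewrite exchange_big; apply: eq_bigr => k _; rewrite -mulr_sumr sum_edge.
Qed.

Lemma common_diag i : p i i = d i.
Proof.
rewrite commonE -sum_edge; apply: eq_bigr => k _; rewrite [e k i]sym_e.
by case: (e i k); rewrite ?mulr1 ?mulr0.
Qed.

Lemma sum_edge_deg : \sum_i \sum_j a i j * d j = deg_sqsum.
Proof.
rewrite exchange_big; apply: eq_bigr => j _.
by rewrite -mulr_suml sum_edge_r expr2.
Qed.

Lemma sum_const (x : R) : \sum_(i < n) x = n%:R * x.
Proof. by rewrite sumr_const card_ord mulr_natl. Qed.

Lemma trace_reduced alpha :
  \tr (reduced_mx alpha e) = alpha * deg_sum - (1 - alpha) * n%:R.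
Proof.
rewrite /mxtrace /deg_sum mulr_sumr -[n%:R]mulr1 -sum_const mulr_sumr -sumrB.
by apply: eq_bigr => i _; rewrite reduced_mxE eqxx irr_e /=; ring.
Qed.

Lemma trace_sqr (M : 'M[R]_n) : M^T = M ->
  \tr (M ^+ 2) = \sum_i \sum_j M i j ^+ 2.
Proof.
move=> symM; rewrite expr2 -mulmxE /mxtrace; apply: eq_bigr => i _.
rewrite mxE; apply: eq_bigr => j _.
by rewrite -{2}symM mxE expr2.
Qed.

(** Off the diagonal an entry is 0 or -(1 - alpha), and its square is (1 - alpha)^2 (1 - a_ij). The
    diagonal supplies the remaining terms. *)
Lemma trace_reduced2 alpha :
  \tr (reduced_mx alpha e ^+ 2) = (1 - alpha) ^+ 2 * (n%:R ^+ 2 - deg_sum)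
    + alpha ^+ 2 * deg_sqsum - 2 * alpha * (1 - alpha) * deg_sum.
Proof.
rewrite trace_sqr ?reduced_mx_sym // /deg_sum /deg_sqsum.
rewrite -addrA !mulr_sumr -sumrB.
have -> : n%:R ^+ 2 - \sum_i d i = \sum_i \sum_(j < n) (1 - a i j).
  rewrite expr2 -[X in _ * X]mulr1 -!sum_const -sumrB.
  by apply: eq_bigr => i _; rewrite -sum_edge -sumrB.
rewrite mulr_sumr -big_split /=; apply: eq_bigr => i _.
rewrite (bigD1 i) //= [in RHS](bigD1 i) //= reduced_mxE eqxx irr_e.
rewrite (eq_bigr (fun j => (1 - alpha) ^+ 2 * (1 - a i j))).
  by rewrite -mulr_sumr /=; ring.
move=> j /negPf ne; rewrite reduced_mxE eq_sym ne.
by case: (e i j) => /=; ring.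
Qed.

Let X := reduced_mx 0 e : 'M[R]_n.

Let XE i j : X i j = a i j - 1.
Proof. by rewrite /X reduced_mxE; ring. Qed.

Let X2E i j : (X ^+ 2) i j = p i j - d i - d j + n%:R.
Proof.
rewrite expr2 -mulmxE mxE commonE -sum_edge -sum_edge_r.
rewrite -[n%:R]mulr1 -sum_const -!sumrB -big_split /=.
by apply: eq_bigr => k _; rewrite !XE; ring.
Qed.

Let dsum (f : 'I_n -> 'I_n -> R) : R := \sum_i \sum_j f i j.

Let eq_dsum f g : (forall i j, f i j = g i j) -> dsum f = dsum g.
Proof. by move=> fg; apply: eq_bigr => i _; apply: eq_bigr => j _. Qed.

Let dsumD f g : dsum (fun i j => f i j + g i j) = dsum f + dsum g.
Proof. by rewrite /dsum -big_split; apply: eq_bigr => i _; rewrite big_split. Qed.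

Let dsumZ c f : dsum (fun i j => c * f i j) = c * dsum f.
Proof. by rewrite mulr_sumr; apply: eq_bigr => i _; rewrite mulr_sumr. Qed.

Let dsum_swap f : dsum (fun i j => f j i) = dsum f.
Proof. exact: exchange_big. Qed.

Let dsum_const (c : R) : dsum (fun _ _ => c) = n%:R ^+ 2 * c.
Proof. by rewrite /dsum !sum_const expr2 mulrA. Qed.

Let dsum_row (f : 'I_n -> R) : dsum (fun i _ => f i) = n%:R * \sum_i f i.
Proof. by rewrite -dsum_swap /dsum sum_const. Qed.

Let dsum_edge : dsum (fun i j => a i j) = deg_sum.
Proof. by apply: eq_bigr => i _; rewrite sum_edge. Qed.

Let dsum_edge_deg : dsum (fun i j => a i j * d j) = deg_sqsum.
Proof. exact: sum_edge_deg. Qed.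

Let dsum_common : dsum (fun i j => p i j) = deg_sqsum.
Proof. by rewrite -sum_edge_deg; apply: eq_bigr => i _; rewrite sum_common. Qed.

Let common_sym i j : p i j = p j i.
Proof.
by congr _%:R; apply: eq_card => k; rewrite !inE andbC sym_e [e i k]sym_e.
Qed.

Lemma trace_reduced3 :
  \tr (X ^+ 3) = triangle_sum - 3 * deg_sqsum + 3 * n%:R * deg_sum - n%:R ^+ 3.
Proof.
transitivity (dsum (fun i j => (p i j - d i - d j + n%:R) * (a i j - 1))).
  rewrite exprSr -mulmxE /mxtrace; apply: eq_bigr => i _; rewrite mxE.
  by apply: eq_bigr => j _; rewrite X2E XE [e j i]sym_e.
(* Some adjacency entries are transposed so that [dsum_swap] turns each term into a double sum
   already evaluated. *)
rewrite (@eq_dsum _ (fun i j => p i j * a i j + (-1 * p i j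
  + (-1 * (a j i * d i) + (-1 * (a i j * d j)
  + (d i + (d j + (n%:R * a i j + - n%:R)))))))).
  rewrite !dsumD !dsumZ dsum_const dsum_row (dsum_swap (fun i _ => d i)) dsum_row.
  rewrite (dsum_swap (fun i j => a i j * d j)) dsum_edge dsum_edge_deg dsum_common.
  by rewrite -/deg_sum -/triangle_sum /dsum -/triangle_sum; ring.
by move=> i j; rewrite [e j i]sym_e; ring.
Qed.

Lemma trace_reduced4 :
  \tr (X ^+ 4) = walk2_sqsum - 4 * walk3_sum + 4 * n%:R * deg_sqsum
    + 2 * deg_sum ^+ 2 - 4 * n%:R ^+ 2 * deg_sum + n%:R ^+ 4.
Proof.
have symX : X^T = X by exact: reduced_mx_sym.
have symX2 : (X ^+ 2)^T = X ^+ 2 by rewrite expr2 -mulmxE trmx_mul symX.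
rewrite (_ : X ^+ 4 = (X ^+ 2) ^+ 2); last by rewrite -exprM.
rewrite trace_sqr //.
have walk3 : dsum (fun i j => p i j * d i) = walk3_sum.
  apply: eq_bigr => i _; rewrite -mulr_suml sum_common mulr_suml.
  by apply: eq_bigr => k _; ring.
have degM : dsum (fun i j => d i * d j) = deg_sum ^+ 2.
  by rewrite expr2 mulr_suml; apply: eq_bigr => i _; rewrite mulr_sumr.
rewrite -/(dsum _) (@eq_dsum _ (fun i j => p i j ^+ 2 + (-2 * (p i j * d i)
  + (-2 * (p j i * d j) + (2 * n%:R * p i j + (d i ^+ 2 + (d j ^+ 2
  + (2 * (d i * d j) + (- (2 * n%:R) * d i
  + (- (2 * n%:R) * d j + n%:R ^+ 2)))))))))).
  rewrite !dsumD !dsumZ dsum_const !dsum_row !(dsum_swap (fun i _ => d i)) !dsum_row.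
  rewrite !(dsum_swap (fun i _ => d i ^+ 2)) !dsum_row degM.
  rewrite (dsum_swap (fun i j => p i j * d i)) walk3 dsum_common.
  by rewrite -/deg_sum -/deg_sqsum /dsum -/walk2_sqsum; ring.
by move=> i j; rewrite X2E [p j i]common_sym; ring.
Qed.

(** The diagonal entries are the degrees; off the diagonal p^2 = p (p - 1) + p. The terms p (p - 1)
    add up to eight times the number of 4-cycles, hence to zero for the path. *)
Lemma walk2_sqsumE : walk2_sqsum
  = \sum_i \sum_(j | j != i) p i j * (p i j - 1) + 2 * deg_sqsum - deg_sum.
Proof.
have E : walk2_sqsum - deg_sqsum
    = \sum_i \sum_(j | j != i) p i j * (p i j - 1) + (deg_sqsum - deg_sum).
  rewrite -{1}dsum_common -!sumrB -big_split; apply: eq_bigr => i _ /=.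
  rewrite -sumrB (bigD1 i) //= common_diag addrC; congr (_ + _).
  by apply: eq_bigr => j _; ring.
by move: E; set Q := \sum_i \sum_(j | _) _; lra.
Qed.

Lemma common_excess_ge0 : 0 <= \sum_i \sum_(j | j != i) p i j * (p i j - 1).
Proof.
apply: sumr_ge0 => i _; apply: sumr_ge0 => j _.
case: (common i j) => [|k]; first by rewrite mul0r.
by rewrite mulr_ge0 ?ler0n // subr_ge0 ler1n.
Qed.

(** The right-hand side is the sum of all off-diagonal common-neighbour counts. *)
Lemma triangle_sum_le : triangle_sum <= deg_sqsum - deg_sum.
Proof.
rewrite -dsum_common -sumrB; apply: ler_sum => i _.
rewrite (bigD1 i) //= irr_e mulr0 add0r [in leRHS](bigD1 i) //= common_diag.
rewrite [leRHS]addrC addKr; apply: ler_sum => j _.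
by rewrite ler_piMr // lern1 leq_b1.
Qed.

(** An edge contributes only if neither of its ends has degree 2, negatively when exactly one of
    them has degree 1. *)
Definition edge_excess : R := \sum_i \sum_j a i j * ((d i - 2) * (d j - 2)).

Lemma edge_excessE : edge_excess = walk3_sum - 4 * deg_sqsum + 4 * deg_sum.
Proof.
rewrite /edge_excess -/(dsum _) (@eq_dsum _ (fun i j => a i j * (d i * d j)
  + (-2 * (a j i * d i) + (-2 * (a i j * d j) + 4 * a i j)))).
  rewrite !dsumD !dsumZ (dsum_swap (fun i j => a i j * d j)) dsum_edge dsum_edge_deg.
  by rewrite /dsum -/walk3_sum; ring.
by move=> i j; rewrite [e j i]sym_e; ring.
Qed.

(* The nonnegative integer (k - 1)(k - 2) / 2, which vanishes only at 1 and 2. *)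
Definition deg_gap (k : nat) : nat := if k is k'.+1 then 'C(k', 2) else 1.

Lemma deg_gapE k : 2 * (deg_gap k)%:R = (k%:R - 1) * (k%:R - 2) :> R.
Proof.
case: k => [|k] /=; first by ring.
have := bin_ffact k 2; rewrite ffactnS ffactn1 => /(congr1 (fun x => x%:R : R)).
rewrite !natrM -[k.+1%:R]natr1 [2`!%:R]/2 mulrC => ->.
by case: k => [|k]; rewrite ?mul0r /= -?natr1; ring.
Qed.

(** The number T of the overview, kept in [nat] so that small values can be treated case by case. *)
Definition total_gap : nat := \sum_i deg_gap (vdeg e i).

Lemma total_gapE : 2 * total_gap%:R = deg_sqsum - 3 * deg_sum + 2 * n%:R.
Proof.
rewrite /total_gap natr_sum mulr_sumr /deg_sqsum /deg_sum mulr_sumr -sumrB.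
rewrite [2 * n%:R]mulrC -sum_const -big_split; apply: eq_bigr => i _ /=.
by rewrite deg_gapE; ring.
Qed.

Let g i : R := (deg_gap (vdeg e i))%:R.
Let leaf i : R := (vdeg e i == 1%N)%:R.

(** For a non-isolated vertex, d - 2 is -1 at a leaf and otherwise lies between 0 and [g]. So an
    edge contributes at most [g i * g j], plus 1 if it joins two leaves. The diagonal terms
    [g i ^+ 2 >= g i] are missing from the square of T. *)
Lemma edge_excess_le : edge_excess
  <= total_gap%:R ^+ 2 - total_gap%:R + \sum_i \sum_j a i j * (leaf i * leaf j).
Proof.
have gg : total_gap%:R ^+ 2 = \sum_i \sum_j g i * g j :> R.
  rewrite /total_gap natr_sum expr2 mulr_suml.
  by apply: eq_bigr => i _; rewrite mulr_sumr.
have g1 : total_gap%:R = \sum_i g i :> R by rewrite /total_gap natr_sum.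
rewrite gg g1 -sumrB -big_split /=; apply: ler_sum => i _.
have off_diag (f : 'I_n -> R) : \sum_j a i j * f j = \sum_(j | j != i) a i j * f j.
  by rewrite (bigD1 i) //= irr_e mul0r add0r.
rewrite (off_diag (fun j => (d i - 2) * (d j - 2))) (off_diag (fun j => leaf i * leaf j)).
rewrite [\sum_j g i * g j](bigD1 i) //=.
have gi : 0 <= g i * g i - g i.
  rewrite /g; case: (deg_gap _) => [|k]; first by rewrite mul0r subr0.
  by rewrite -natr1; have : 0 <= k%:R :> R by []; nra.
rewrite [X in _ <= X + _]addrAC -[leLHS]add0r -[leRHS]addrA; apply: lerD => //.
rewrite -big_split; apply: ler_sum => j ne /=.
case Eij: (e i j); rewrite ?mul0r ?addr0 ?mul1r; last by rewrite mulr_ge0 ?ler0n.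
have pos u w : e u w -> (0 < vdeg e u)%N by move=> uw; apply/card_gt0P; exists w.
have bnd u : (0 < vdeg e u)%N ->
    [\/ d u - 2 = -1 /\ leaf u = 1, d u - 2 = 0 | 0 <= d u - 2 <= g u /\ leaf u = 0].
  rewrite /leaf /g; have := deg_gapE (vdeg e u).
  case: (vdeg e u) => [|[|[|k]]] //= H _.
  - by constructor 1; split=> //; ring.
  - by constructor 2; rewrite subrr.
  - constructor 3; split=> //; move: H; rewrite -!natr1.
    have : 0 <= k%:R :> R by [].
    by move=> k0 H; apply/andP; split; nra.
have gp u : 0 <= g u by rewrite ler0n.
have lp u : 0 <= leaf u by rewrite ler0n.
have := mulr_ge0 (gp i) (gp j); have := mulr_ge0 (lp i) (lp j).
have := bnd j (pos j i _); rewrite sym_e => /(_ Eij).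
have := bnd i (pos i j Eij).
case=> [[-> ->]|->|[/andP[i0 ig] ->]]; case=> [[-> ->]|->|[/andP[j0 jg] ->]]; nra.
Qed.

Lemma leaf_edges_le : \sum_i \sum_j a i j * (leaf i * leaf j) <= \sum_i leaf i.
Proof.
apply: ler_sum => i _; rewrite [leRHS](_ : _ = \sum_j a i j * leaf i).
  apply: ler_sum => j _; rewrite mulrA ler_piMr ?mulr_ge0 ?ler0n //.
  by rewrite /leaf lern1 leq_b1.
rewrite -mulr_suml sum_edge /leaf; case: eqP => [->|_]; rewrite ?mulr1 ?mulr0 //.
Qed.

(** Ordered pairs of distinct leaves are counted; this is sharper than [leaf_edges_le] for fewer
    than two leaves. *)
Lemma leaf_edges_le2 : \sum_i \sum_j a i j * (leaf i * leaf j)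
  <= (\sum_i leaf i) ^+ 2 - \sum_i leaf i.
Proof.
rewrite expr2 mulr_suml -sumrB; apply: ler_sum => i _.
rewrite mulr_sumr (bigD1 i) //= irr_e mul0r add0r.
rewrite [\sum_j leaf i * leaf j](bigD1 i) //=.
have -> : leaf i * leaf i = leaf i by rewrite -natrM mulnb andbb.
rewrite [leRHS]addrC addKr; apply: ler_sum => j _.
by rewrite ler_piMl ?mulr_ge0 ?ler0n // lern1 leq_b1.
Qed.

(** Holds termwise, with equality at degrees 1, 2 and 3. *)
Lemma leaf_sum_le : \sum_i leaf i <= total_gap%:R - deg_sum + 2 * n%:R.
Proof.
rewrite /total_gap natr_sum /deg_sum -sumrB [2 * _]mulrC -sum_const -big_split.
apply: ler_sum => i _ /=; have := deg_gapE (vdeg e i); rewrite /leaf.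
move: (deg_gap _) => b; case: (vdeg e i) => [|[|[|k]]] /=; [lra | lra | lra |].
have : 0 <= k%:R :> R by [].
by rewrite -!natr1; nra.
Qed.

Lemma leaf_sum_triangle : triangle_sum != 0 -> \sum_i leaf i <= n%:R - 3.
Proof.
move=> tri; have [i [j [k [ij jk ki]]]] : exists i j k, [/\ e i j, e j k & e k i].
  have [/existsP[i /existsP[j /existsP[k /and3P[]]]]|none] :=
    boolP [exists i, exists j, exists k, [&& e i j, e j k & e k i]].
    by exists i, j, k.
  case/eqP: tri; apply: big1 => i _; apply: big1 => j _.
  rewrite commonE mulr_suml big1 // => k _.
  move: none; rewrite negb_exists => /forallP/(_ i).
  rewrite negb_exists => /forallP/(_ k); rewrite negb_exists => /forallP/(_ j).
  rewrite [e j i]sym_e -!natrM !mulnb -andbA => /negPf-> //.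
have ne u w : e u w -> u != w by apply: contraTneq => ->; rewrite irr_e.
have deg2 u x y : e u x -> e u y -> x != y -> leaf u = 0.
  move=> ux uy xy; rewrite /leaf; case: eqP => // d1.
  by move: xy; rewrite (vdeg1_neighbour d1 uy ux) eqxx.
have split3 (f : 'I_n -> R) : \sum_u f u
    = f i + (f j + (f k + \sum_(u | (u != i) && (u != j) && (u != k)) f u)).
  rewrite (bigD1 i) //= (bigD1 j) /=; last by rewrite eq_sym ne.
  by rewrite (bigD1 k) //= ne // eq_sym ne.
rewrite split3 (deg2 i j k) ?ne //; last by rewrite sym_e.
rewrite (deg2 j k i) ?ne //; last by rewrite sym_e.
rewrite (deg2 k i j) ?ne //; last by rewrite sym_e.
rewrite !add0r -[n%:R]mulr1 -sum_const split3.
set S := \sum_(_ | _) 1; have -> : 1 + (1 + (1 + S)) - 3 = S by ring.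
by apply: ler_sum => u _; rewrite /leaf lern1 leq_b1.
Qed.

(* For alpha = 0, the last two hypotheses come from the traces of X^3 and X^4. *)
Lemma total_gap_eq0 : (1 < n)%N -> deg_sum = 2 * n%:R - 2 ->
  triangle_sum = 6 * total_gap%:R ->
  ((2 < n)%N -> total_gap%:R * (2 * n%:R - 7) <= edge_excess) -> total_gap = 0%N.
Proof.
move=> n1 S1 T3 F.
(* The triangle bound reads 6T <= 2T + 2n - 4. *)
have := triangle_sum_le; have := total_gapE; rewrite T3 S1 => S2 Tle.
have {S2}Tle : 2 * total_gap%:R <= n%:R - 2 :> R by lra.
have Tn : (2 * total_gap + 2 <= n)%N.
  by rewrite -(ler_nat R) natrD natrM; lra.
have leaf1 := leaf_sum_le; rewrite S1 in leaf1.
have E1 := edge_excess_le; have N1 := leaf_edges_le; have N2 := leaf_edges_le2.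
move: E1 N1 N2 F leaf1 Tle Tn T3; set N := \sum_i \sum_j _; set L := \sum_i leaf i.
case: total_gap => [|[|k]] // E1 N1 N2 F leaf1 Tle Tn T3; exfalso.
  (* Case T = 1: there is a triangle, so L <= n - 3, and also L <= 3. Then 2n - 7 <= N <= L leaves n
     = 4 or 5. For n = 4, L <= 1 makes N vanish; for n = 5, it would follow that 3 <= L <= 2. *)
  have := leaf_sum_triangle; rewrite T3 mulr1 pnatr_eq0 => /(_ isT); rewrite -/L => L3.
  have L0 : 0 <= L by apply: sumr_ge0 => i _; rewrite ler0n.
  have n3 : (2 < n)%N by lia.
  have {}F := F n3.
  have n5 : (n <= 5)%N by rewrite -(ler_nat R); lra.
  have : n = 4%N \/ n = 5%N by lia.
  case=> /(congr1 (fun k => k%:R : R)) En; move: F L3; rewrite En => F L3.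
    have LL : L * (1 - L) >= 0 by rewrite mulr_ge0 // subr_ge0; lra.
    by move: N2 E1; rewrite expr2; lra.
  by lra.
(* Case T >= 2: L <= T + 2 and n >= 2T + 2 turn the bounds into 3T^2 - 3T <= 2, which fails. *)
have n3 : (2 < n)%N by lia.
have {}F := F n3.
have k0 : 0 <= k%:R :> R by [].
by move: E1 F leaf1 Tle; rewrite -!natr1; nra.
Qed.
End Moments.

(** * Comparison with the path *)

Section PathMoments.
Variables (R : realFieldType) (n : nat).
Hypothesis n_gt1 : (1 < n)%N.
Local Notation P := (@path_rel n).

Let vdeg_ends (j : 'I_n) :
  (vdeg P j)%:R = 2 - (j == 0%N :> nat)%:R - (j == n.-1 :> nat)%:R :> R.
Proof.
rewrite vdeg_path; have jlt := ltn_ord j.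
have [->|j0] := eqVneq (j : nat) 0%N; first by rewrite n_gt1 ltn_eqF /=; [ring | lia].
have [->|jn] := eqVneq (j : nat) n.-1.
  by rewrite prednK ?ltnn; [have -> : (0 < n.-1)%N by [lia]; rewrite /=; ring | lia].
have -> : (j.+1 < n)%N by lia.
have -> : (0 < j)%N by lia.
by rewrite /=; ring.
Qed.

Let sum_ends (c : R) (f g : R) :
  \sum_(j < n) (c - f * (j == 0%N :> nat)%:R - g * (j == n.-1 :> nat)%:R)
  = c * n%:R - f - g.
Proof.
have one k : (k < n)%N -> \sum_(j < n) (j == k :> nat)%:R = 1 :> R.
  move=> kn; have := sum_delta n k (fun=> 1 : R); rewrite kn mul1r.
  by apply: etrans; apply: eq_bigr => j _; rewrite mulr1.
rewrite !sumrB -!mulr_sumr !one ?mulr1; [|lia..].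
by rewrite sumr_const card_ord mulr_natr.
Qed.

Lemma path_deg_sum : deg_sum R P = 2 * n%:R - 2.
Proof.
rewrite /deg_sum (eq_bigr (fun j : 'I_n =>
  2 - 1 * (j == 0%N :> nat)%:R - 1 * (j == n.-1 :> nat)%:R)) ?sum_ends.
  by ring.
by move=> j _; rewrite vdeg_ends !mul1r.
Qed.

Lemma path_deg_sqsum : deg_sqsum R P = 4 * n%:R - 6.
Proof.
rewrite /deg_sqsum (eq_bigr (fun j : 'I_n =>
  4 - 3 * (j == 0%N :> nat)%:R - 3 * (j == n.-1 :> nat)%:R)) ?sum_ends.
  by ring.
move=> j _; rewrite vdeg_ends.
have [->|j0] := eqVneq (j : nat) 0%N; first by rewrite ltn_eqF /=; [ring | lia].
by case: eqP => _ /=; ring.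
Qed.

Lemma path_triangle_sum : triangle_sum R P = 0.
Proof.
apply: big1 => i _; apply: big1 => j _; rewrite commonE mulr_suml big1 // => k _.
rewrite -!natrM !mulnb (_ : _ && _ = false) //; apply/negbTE.
by rewrite /path_rel; lia.
Qed.

Lemma path_common_excess : \sum_i \sum_(j | j != i)
  (common P i j)%:R * ((common P i j)%:R - 1) = 0 :> R.
Proof.
apply: big1 => i _; apply: big1 => j ne.
suff : (common P i j <= 1)%N by case: (common P i j) => [|[|]] // _; ring.
apply/card_le1_eqP => k l; rewrite !inE /path_rel => Hk Hl; apply: val_inj => /=.
by move: ne; rewrite -val_eqE /=; lia.
Qed.

(** The two ends of the path are not adjacent, so every edge has an end of degree 2. *)
Lemma path_edge_excess : (2 < n)%N -> edge_excess R P = 0.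
Proof.
move=> n2; apply: big1 => i _; apply: big1 => j _; rewrite !vdeg_ends.
have [ij|] := boolP (path_rel i j); last by rewrite mul0r.
have ends (k : 'I_n) : 2 - (k == 0%N :> nat)%:R - (k == n.-1 :> nat)%:R - 2 = 0 :> R
    \/ (k == 0%N :> nat) || (k == n.-1 :> nat).
  case: (_ == 0%N); first by right.
  by case: (_ == n.-1); [right | left; rewrite /=; ring].
have [->|hi] := ends i; first by rewrite mul0r mulr0.
have [->|hj] := ends j; first by rewrite !mulr0.
by move: ij; rewrite /path_rel; lia.
Qed.
End PathMoments.

Lemma cospectral_total_gap (R : rcfType) (alpha : R) n (e : rel 'I_n) :
  0 <= alpha -> alpha < 1 -> (1 < n)%N -> simple_graph e ->
  char_poly (reduced_mx alpha e) = char_poly (reduced_mx alpha (@path_rel n)) ->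
  deg_sum R e = 2 * n%:R - 2 /\ total_gap e = 0%N.
Proof.
move=> alpha0 alpha1 n1 [sym_e irr_e] cosp.
have symP := @path_sym n; have irrP := @path_irrefl n.
have tr k := symmetric_cospectral_trace k (reduced_mx_sym alpha sym_e)
               (reduced_mx_sym alpha symP) cosp.
clear cosp.
have gapE := @total_gapE R n e.
have S1P := path_deg_sum R n1; have S2P := path_deg_sqsum R n1.
have tr2 := tr 2%N; rewrite !trace_reduced2 // S1P S2P in tr2.
(* For alpha = 0 the first trace says nothing about degrees, and the second gives only their sum. *)
have [a0|a0] := eqVneq alpha 0; last first.
  have ap : 0 < alpha by rewrite lt_def a0.
  have tr1 := tr 1%N; rewrite !expr1 !trace_reduced // S1P in tr1.
  have S1 : deg_sum R e = 2 * n%:R - 2 by apply: (mulfI a0); lra.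
  split=> //; rewrite S1 in tr2 gapE.
  have a20 : alpha ^+ 2 != 0 by rewrite expf_neq0.
  have S2 : deg_sqsum R e = 4 * n%:R - 6 by apply: (mulfI a20); lra.
  by apply/eqP; rewrite -(pnatr_eq0 R); apply/eqP; move: gapE; rewrite S2; lra.
subst alpha.
have S1 : deg_sum R e = 2 * n%:R - 2 by move: tr2; rewrite subr0 expr1n expr0n /=; lra.
split=> //; rewrite S1 in gapE.
have {gapE}S2 : deg_sqsum R e = 2 * (total_gap e)%:R + 4 * n%:R - 6 by lra.
(* The triangle sum is three times the difference of the sums of squared degrees, that is 6T. *)
have tr3 := tr 3%N; rewrite !trace_reduced3 // S1P S2P S1 S2 path_triangle_sum // in tr3.
apply: (@total_gap_eq0 R n e sym_e irr_e n1 S1); first by lra.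
move=> n2; have tr4 := tr 4%N; rewrite !trace_reduced4 // S1P S2P S1 S2 in tr4.
have F := @edge_excessE R n e sym_e; rewrite S1 S2 in F.
have FP := @edge_excessE R n _ symP; rewrite S1P S2P path_edge_excess // in FP.
have Q := @walk2_sqsumE R n e sym_e; rewrite S1 S2 in Q.
have QP := @walk2_sqsumE R n _ symP; rewrite S1P S2P path_common_excess // in QP.
have Q0 := @common_excess_ge0 R n e.
move: Q Q0; set q := \sum_i \sum_(j | _) _ => Q Q0.
(* The fourth moment now says that 4 [edge_excess] = q + 4T (2n - 7), where q >= 0. *)
rewrite Q QP in tr4; lra.
Qed.

Lemma cospectral_path (R : rcfType) (alpha : R) n (e : rel 'I_n) :
  0 <= alpha -> alpha < 1 -> (1 < n)%N -> simple_graph e ->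
  char_poly (reduced_mx alpha e) = char_poly (reduced_mx alpha (@path_rel n)) ->
  graph_iso e (@path_rel n).
Proof.
move=> alpha0 alpha1 n1 sg_e cosp; have [sym_e irr_e] := sg_e.
have [S1 gap0] := cospectral_total_gap alpha0 alpha1 n1 sg_e cosp.
have rkE x := symmetric_cospectral_rank x (reduced_mx_sym alpha sym_e)
                (reduced_mx_sym alpha (@path_sym n)) cosp.
clear cosp.
have deg u : (0 < vdeg e u <= 2)%N.
  have /eqP := gap0; rewrite sum_nat_eq0 => /forallP/(_ u) /=.
  case: (vdeg e u) => [|[|[|k]]] //=.
  by rewrite -leqn0 leqNgt bin_gt0.
have sum_deg : (\sum_u vdeg e u + 2 = 2 * n)%N.
  apply/eqP; rewrite -(eqr_nat R) natrD natrM natr_sum; apply/eqP.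
  by move: S1; rewrite /deg_sum => ->; ring.
case: (path_or_cycle sg_e deg sum_deg) => // -[s [v [s2 sn cyc]]].
have [t /andP[t1 t2] rk] := cycle_reduced_corank alpha sym_e s2 cyc.
rewrite rkE in rk.
exfalso; case: (n) sn rk => [|k] sn rk; first by clear rk; lia.
(* A cycle of length at least 3 besides two further vertices gives n >= 5, as the simplicity of the
   path's eigenvalue requires. *)
have k3 : (3 < k)%N by clear rk; lia.
have := leq_trans (leq_add (path_reduced_rank alpha0 alpha1 t1 t2 k3) (leqnn 2)) rk.
by rewrite addn2 ltnn.
Qed.

(** * Complements and the conclusion *)

Lemma compl_relK n (e : rel 'I_n) : irreflexive e -> compl_rel (compl_rel e) =2 e.
Proof.
move=> irr_e i j; rewrite /compl_rel; case: eqVneq => [->|_] /=.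
  by rewrite irr_e.
by rewrite negbK.
Qed.

Lemma compl_simple n (e : rel 'I_n) : simple_graph e -> simple_graph (compl_rel e).
Proof.
move=> [sym_e irr_e]; split=> [i j|i]; rewrite /compl_rel.
  by rewrite eq_sym sym_e.
by rewrite eqxx.
Qed.

Lemma eq_Aalpha_mx (R : comNzRingType) (alpha : R) n (e1 e2 : rel 'I_n) :
  e1 =2 e2 -> Aalpha_mx alpha e1 = Aalpha_mx alpha e2.
Proof.
move=> eq_e; apply/matrixP => i j; rewrite !mxE eq_e /vdeg.
by rewrite (eq_card (B := [pred j | e2 i j])) // => k; rewrite !inE eq_e.
Qed.

Lemma graph_iso_compl n (e1 e2 : rel 'I_n) : irreflexive e1 ->
  graph_iso (compl_rel e1) e2 -> graph_iso e1 (compl_rel e2).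
Proof.
move=> irr1 [f [bij_f iso_f]]; exists f; split=> // i j.
rewrite -(compl_relK irr1) {1}/compl_rel iso_f /compl_rel.
by rewrite (inj_eq (bij_inj bij_f)).
Qed.

Theorem theorem2p5 (R : rcfType) (n : nat) (alpha : R) :
  0 <= alpha -> alpha < 1 -> DAalphaS alpha (compl_rel (@path_rel n)).
Proof.
move=> alpha0 alpha1 m e sg_e cosp; have [sym_e irr_e] := sg_e.
have E : m = n.
  have /(congr1 (fun p : {poly R} => size p)) := cosp.
  by rewrite !size_char_poly => -[].
subst m; have [n1|n1] := leqP n 1.
  exists id; split=> [|i j]; first by exists id.
  have -> : j = i by apply: val_inj => /=; have := ltn_ord i; have := ltn_ord j; lia.
  by rewrite irr_e /compl_rel eqxx.
(* The complement of [e] is compared with the path; its own complement is [e] again, so the spectral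
   hypothesis applies. *)
apply: graph_iso_compl => //.
apply: (cospectral_path alpha0 alpha1 n1 (compl_simple sg_e)).
apply: reduced_mx_cospectral.
- exact: compl_simple.
- by split; [exact: path_sym | exact: path_irrefl].
by rewrite /same_Aalpha_spectrum (eq_Aalpha_mx _ (compl_relK irr_e)).
Qed.
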